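(* Let $C$ be an alternating configuration of $m$ crossings in a virtual knot diagram $D$ (where $m \geq 1$). Let $L = L_d \cup L_a$ be the link formed by smoothing the crossings in $C$, where $L_d$ is the sublink formed from the descending components of $L$, and $L_a$ is the sublink formed from the ascending components of $L$. Then at most one permutation corresponding to $C$ makes a non-zero contribution to $\Delta_0(D)$, and its contribution is $$(1-uv)^{neg(C)}(1-(uv)^{-1})^{pos(C)}(-1)^{m+\vert L_d \vert}u^{-U(L_a)}v^{-O(L_a)},$$ where $U(L_a)$ and $O(L_a)$ are the number of under- and over-crossings (at crossings of $D$ not in $C$) along the components of $L_a$, counted with sign, $neg(C)$ and $pos(C)$ are the number of negative and positive crossings in $C$, and $\vert L_d \vert$ is the number of components of $L_d$.
   Context: $D$ is an oriented virtual knot diagram with $n\ge1$ classical crossings $c_1,\dots,c_n$. An arc of $D$ runs from one classical crossing passage to the next one (virtual crossings are ignored), so there are $2n$ arcs $a_1,\dots,a_{2n}$, labelled so that the arcs coming into $c_i$ are $a_{2i-1}$ and $a_{2i}$: if $c_i$ is positive, $a_{2i-1}$ is the incoming under-strand and $a_{2i}$ the incoming over-strand; if $c_i$ is negative, $a_{2i-1}$ is the incoming over-strand and $a_{2i}$ the incoming under-strand. $M$ is the block diagonal matrix with blocks $M_1,\dots,M_n$, where $M_i=\begin{pmatrix} u^{-1} & 1-(uv)^{-1}\\ 0& v^{-1}\end{pmatrix}$ for $c_i$ positive and $M_i=\begin{pmatrix} v&0\\ 1-uv& u\end{pmatrix}$ for $c_i$ negative. $\pi$ is the $2n$-cycle on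 $\{1,\dots,2n\}$ such that $a_{\pi(i)}$ is the arc following $a_i$ along the knot, and $P_{ij}=1$ if $\pi(i)=j$, else $0$. $\Delta_0(D)(u,v)=\det(M-P)$. Let $C$ be a set of classical crossings. A permutation $\sigma\in S_{2n}$ corresponds to $C$ if $\sigma(2i-1)=2i$ for each positive $c_i\in C$, $\sigma(2i)=2i-1$ for each negative $c_i\in C$, and $\sigma(t)\in\{t,\pi(t)\}$ for all other $t$. The contribution to $\Delta_0(D)$ of a permutation $\sigma$ corresponding to $C$ is $(-1)^\sigma\prod_{t=1}^{2n} e_t$, where $(-1)^\sigma$ is the sign of $\sigma$, and: $e_{2i-1}=1-(uv)^{-1}$ for positive $c_i\in C$; $e_{2i}=1-uv$ for negative $c_i\in C$; for every other $t$, $e_t=-1$ if $\sigma(t)=\pi(t)$, and $e_t=M_{tt}$ if $\sigma(t)=t$. (Thus if an entry of $M-P$ is a sum of a nonzero off-diagonal entry of $M$ and the entry $-1$ of $-P$, the determinant term is split into two, one for each summand, attributed to sets $C$ with and without that crossing.) The sum of all contributions over all $C$ and $\sigma$ corresponding to $C$ is $\Delta_0(D)$. $C$ is alternating if, going around the knot, the over-crossing and under-crossing passages through crossings of $C$ alternate (ignoring other crossings). An alternating $C$ with $m$ crossings divides the knot into $2m$ segments: $m$ ascending segments (from an under-crossing in $C$ to the next over-crossing in $C$) and $m$ descending segments (from an over-crossing in $C$ to the next under-crossing in $C$). Smoothing a crossing in $C$ is the oriented smoothing: the incoming over-strand is joined to the outgoing under-strand and the incoming under-strand to the outgoing over-strand;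 so each smoothing joins ascending segments to ascending ones and descending to descending. Each component of the resulting link consists entirely of ascending segments or entirely of descending segments and is called ascending or descending accordingly. *)

(* Defs.v *)
From HB Require Import structures.
From mathcomp Require Import all_boot all_order all_algebra all_fingroup.

Set Implicit Arguments.
Unset Strict Implicit.
Unset Printing Implicit Defensive.

Import Order.TTheory GRing.Theory Num.Theory.
Local Open Scope ring_scope.

(** The field Q(u, v), in which the Laurent polynomials Z[u^+-1, v^+-1] embed. *)
Definition Kuv : fieldType := {fraction {poly {poly int}}}.
Definition u : Kuv := tofrac ('X%:P).
Definition v : Kuv := tofrac 'X.

(** An oriented virtual knot diagram, given by its signed Gauss data: the signs
    of the [ncr] classical crossings and the successor permutation of the
    [2 * ncr] arcs, numbered as explained below. Virtual crossings leave no
    trace in these data, and every choice of signs and of a [2 * ncr]-cycle is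
    realised by a virtual knot diagram. Indices are 0-based: the arcs coming
    into crossing [i] are [2i] and [2i + 1] (see [is_over] for which is which),
    and an arc also stands for the crossing passage in which it ends. *)
Record vknot := VKnot {
  ncr : nat;
  ncr_gt0 : (0 < ncr)%N;
  positive : 'I_ncr -> bool;
  next : 'S_(ncr.*2);
  next_cycle : forall s t : 'I_(ncr.*2), t \in porbit next s
}.

Definition arc (D : vknot) := 'I_((ncr D).*2).

Lemma fst_arc_subproof n (i : 'I_n) : (i.*2 < n.*2)%N.
Proof. by rewrite ltn_double. Qed.

Lemma snd_arc_subproof n (i : 'I_n) : (i.*2.+1 < n.*2)%N.
Proof. by rewrite ltn_Sdouble. Qed.

Lemma crossing_subproof n (t : 'I_(n.*2)) : (t./2 < n)%N.
Proof. by rewrite ltn_half_double. Qed.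

Definition fst_arc n (i : 'I_n) : 'I_(n.*2) := Ordinal (fst_arc_subproof i).
Definition snd_arc n (i : 'I_n) : 'I_(n.*2) := Ordinal (snd_arc_subproof i).

(** The crossing at which an arc ends, and the other arc ending there. *)
Definition crossing n (t : 'I_(n.*2)) : 'I_n := Ordinal (crossing_subproof t).
Definition partner n (t : 'I_(n.*2)) : 'I_(n.*2) :=
  if odd t then fst_arc (crossing t) else snd_arc (crossing t).

Lemma crossing_partner n (t : 'I_(n.*2)) : crossing (partner t) = crossing t.
Proof.
by apply: val_inj; rewrite /partner; case: odd; rewrite /= ?uphalf_double ?doubleK.
Qed.

Lemma partnerK n : involutive (@partner n).
Proof.
move=> t; apply: val_inj; rewrite {1}/partner crossing_partner /partner.
have := odd_double_half t.
by case: (odd t) => /= <-; rewrite /= odd_double.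
Qed.

(** The second arc at a positive crossing and the first arc at a negative one
    are the incoming over-strands; the other two are the under-strands. *)
Definition is_over (D : vknot) (t : arc D) : bool :=
  odd t == positive (crossing t).

Definition crossing_sign (D : vknot) (i : 'I_(ncr D)) : int :=
  if positive i then 1 else -1.

(** Entries of the 2 x 2 block of a crossing; [r] and [c] are the (0-based) row
    and column. *)
Definition block_entry (pos r c : bool) : Kuv :=
  match pos, r, c with
  | true,  false, false => u^-1
  | true,  false, true  => 1 - (u * v)^-1
  | true,  true,  false => 0
  | true,  true,  true  => v^-1
  | false, false, false => v
  | false, false, true  => 0
  | false, true,  false => 1 - u * v
  | false, true,  true  => u
  end.

Definition Mmx (D : vknot) : 'M[Kuv]_((ncr D).*2) :=
  \matrix_(s, t) if crossing s == crossing t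
                 then block_entry (positive (crossing s)) (odd s) (odd t)
                 else 0.

Definition Pmx (D : vknot) : 'M[Kuv]_((ncr D).*2) :=
  \matrix_(s, t) (next D s == t)%:R.

Definition Delta0 (D : vknot) : Kuv := \det (Mmx D - Pmx D).

Section Configuration.

Variables (D : vknot) (C : {set 'I_(ncr D)}).

(** The arcs whose row receives the off-diagonal entry of [Mmx]: those coming
    into a crossing of [C] along the under-strand. *)
Definition is_turn (t : arc D) : bool := (crossing t \in C) && ~~ is_over t.

Definition corresponds (s : 'S_((ncr D).*2)) : bool :=
  [forall t : arc D,
     if is_turn t then s t == partner t else (s t == t) || (s t == next D t)].

Definition contribution_entry (s : 'S_((ncr D).*2)) (t : arc D) : Kuv :=
  if is_turn t then
    if positive (crossing t) then 1 - (u * v)^-1 else 1 - u * v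
  else if s t == next D t then -1
  else Mmx D t t.

Definition contribution (s : 'S_((ncr D).*2)) : Kuv :=
  (-1) ^+ s * \prod_(t : arc D) contribution_entry s t.

(** [C_from f t] is the first passage through a crossing of [C] met when
    iterating [f] from [t], [t] included. *)
Definition C_from (f : arc D -> arc D) (t : arc D) : arc D :=
  head t [seq s <- traject f t (ncr D).*2 | crossing s \in C].

Definition alternating : bool :=
  [forall (t : arc D | crossing t \in C),
     is_over (C_from (next D) (next D t)) != is_over t].

(** Each arc lies in one of the segments cut out by [C]; these are the passages
    through [C] at which that segment starts and ends. *)
Definition seg_start (t : arc D) : arc D :=
  C_from (next D)^-1%g ((next D)^-1%g t).
Definition seg_end (t : arc D) : arc D := C_from (next D) t.

Definition ascending (t : arc D) : bool :=
  ~~ is_over (seg_start t) && is_over (seg_end t).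
Definition descending (t : arc D) : bool :=
  is_over (seg_start t) && ~~ is_over (seg_end t).

(** The arc following [t] once the crossings of [C] are smoothed: the arc
    leaving a crossing along a strand is the [next] of the arc entering along
    it, and a smoothing exchanges the two strands. *)
Definition smooth_fun (t : arc D) : arc D :=
  next D (if crossing t \in C then partner t else t).

Lemma smooth_fun_inj : injective smooth_fun.
Proof.
apply: (inj_comp perm_inj) => s t.
case: ifP => Cs; case: ifP => Ct // eq_st.
- exact: (inv_inj (@partnerK _)) eq_st.
- by rewrite -eq_st crossing_partner Cs in Ct.
- by rewrite eq_st crossing_partner Ct in Cs.
Qed.

Definition smoothing : 'S_((ncr D).*2) := perm smooth_fun_inj.

(** Components of the smoothed link, as sets of arcs. *)
Definition components : {set {set arc D}} := porbits smoothing.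
Definition L_d : {set {set arc D}} :=
  [set K in components | [forall t in K, descending t]].
Definition L_a : {set {set arc D}} :=
  [set K in components | [forall t in K, ascending t]].

(** Signed counts of the under- and over-passages, at crossings not in [C],
    along the components of a sublink [L]. *)
Definition U_count (L : {set {set arc D}}) : int :=
  \sum_(K in L) \sum_(t in K | (crossing t \notin C) && ~~ is_over t)
    crossing_sign (crossing t).
Definition O_count (L : {set {set arc D}}) : int :=
  \sum_(K in L) \sum_(t in K | (crossing t \notin C) && is_over t)
    crossing_sign (crossing t).

Definition pos_count : nat := #|[set i in C | positive i]|.
Definition neg_count : nat := #|[set i in C | ~~ positive i]|.

End Configuration.

Lemma same_crossing n (s t : 'I_(n.*2)) :
  (crossing s == crossing t) = (t == s) || (t == partner s).
Proof.
apply/eqP/orP => [e|[/eqP->|/eqP->]]; rewrite ?crossing_partner //.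
have et : t = (odd t + s./2.*2)%N :> nat.
  by have /(congr1 val) /= -> := e; rewrite odd_double_half.
have es : s = (odd s + s./2.*2)%N :> nat by rewrite odd_double_half.
case: (boolP (odd s == odd t)) => [/eqP o|o]; [left | right]; apply/eqP/val_inj.
  by rewrite /= et -o -es.
rewrite /= et /partner; case: (odd s) o => /=; case: (odd t) => //=.
Qed.

Lemma odd_partner n (t : 'I_(n.*2)) : odd (partner t) = ~~ odd t.
Proof. by rewrite /partner; case: ifP; rewrite /= odd_double. Qed.

Lemma partner_neq n (t : 'I_(n.*2)) : partner t != t.
Proof. by apply/eqP => e; have := odd_partner t; rewrite e; case: odd. Qed.

Lemma next_neq (D : vknot) (t : arc D) : next D t != t.
Proof.
apply/eqP => nt; have := next_cycle t (partner t).
have /eqP : porbit (next D) t = [set t].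
  by apply/setP=> x; rewrite inE; apply/porbitP/eqP => [[k ->]|->];
     [elim: k => [|k IH]; rewrite ?expg0 ?perm1 // expgS permM nt
     | exists 0%N; rewrite expg0 perm1].
by move/eqP->; rewrite inE (negPf (partner_neq t)).
Qed.

(** The contributions add up to [Delta0]. *)
Lemma Delta0_contributions (D : vknot) :
  Delta0 D = \sum_(C : {set 'I_(ncr D)})
               \sum_(s : 'S_((ncr D).*2) | corresponds C s) contribution C s.
Proof.
rewrite (exchange_big_dep xpredT) //=; apply: eq_bigr => s _.
pose A (t : arc D) : Kuv :=
  if ~~ is_over t && (s t == partner t) then
    (if positive (crossing t) then 1 - (u * v)^-1 else 1 - u * v) else 0.
pose B (t : arc D) : Kuv :=
  if s t == next D t then -1 else if s t == t then Mmx D t t else 0.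
have -> : \prod_t (Mmx D - Pmx D) t (s t) = \prod_t (A t + B t).
  apply: eq_bigr => t _.
  rewrite !mxE same_crossing [next D t == _]eq_sym /A /B /is_over.
  have [->|nt] := eqVneq (s t) t.
    rewrite [t == next D t]eq_sym (negPf (next_neq t)) [t == partner t]eq_sym.
    by rewrite (negPf (partner_neq t)) andbF add0r subr0 ?mxE ?eqxx.
  have [->|] := eqVneq (s t) (partner t); last first.
    by move=> _; rewrite andbF; case: (s t == next D t); rewrite /= ?subr0 ?sub0r ?add0r.
  rewrite odd_partner !orbT andbT.
  case: (positive _); case: (odd t); case: (partner t == next D t) => //=;
    by rewrite subr0 addr0.
rewrite bigA_distr.
pose T (C : {set 'I_(ncr D)}) : {set arc D} := [set t | is_turn C t].
pose T' (J : {set arc D}) : {set 'I_(ncr D)} := (@crossing _) @: J.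
rewrite (bigID (fun J : {set arc D} => [forall t in J, ~~ is_over t])) /=.
rewrite [X in _ + X]big1 ?addr0; last first.
  move=> J /forallPn[t]; rewrite negb_imply negbK => /andP[tJ ot].
  by apply/eqP/prodf_eq0; exists t; rewrite // tJ /A ot.
rewrite (reindex_onto T T') /=; last first.
  move=> J /forallP HJ; apply/setP=> t; rewrite inE /is_turn.
  apply/andP/idP => [[/imsetP[r rJ e] nt]|tJ]; last first.
    by split; [apply: imset_f | have := HJ t; rewrite tJ].
  have /eqP := esym e; rewrite same_crossing => /orP[/eqP->//|/eqP tr].
  have := HJ r; rewrite rJ /=; move: nt.
  by rewrite tr /is_over crossing_partner odd_partner; case: odd; case: positive.
rewrite big_distrr [RHS]big_mkcond [LHS]big_mkcond /=.
apply: eq_bigr => C _.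
have -> : [forall t in T C, ~~ is_over t] && (T' (T C) == C).
  apply/andP; split; first by apply/forall_inP=> t; rewrite inE => /andP[].
  apply/eqP/setP=> i; apply/imsetP/idP => [[t]|iC].
    by rewrite inE => /andP[tC _ ->].
  pose t : arc D := fst_arc i.
  have ct : crossing t = i by apply: val_inj; rewrite /= doubleK.
  have [ot|nt] := boolP (is_over t); last by exists t; rewrite // inE /is_turn ct iC.
  exists (partner t); rewrite ?crossing_partner // inE /is_turn crossing_partner.
  rewrite ct iC /=; move: ot; rewrite /is_over crossing_partner odd_partner.
  by case: odd; case: positive.
case: ifP => [/forallP cs|/forallPn[t ns]].
  rewrite /contribution; congr (_ * _); apply: eq_bigr => t _.
  rewrite inE /contribution_entry; have := cs t; rewrite /A /B.
  case: ifP => [/andP[_ ->] -> //|_].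
  by case: (s t == next D t) => //; rewrite orbF => ->.
apply/eqP; rewrite mulf_eq0; apply/orP; right; apply/prodf_eq0; exists t => //.
rewrite inE /A /B; move: ns; case: ifP => [/andP[_ ->] /negPf-> //|_].
by rewrite negb_or => /andP[/negPf-> /negPf->].
Qed.

(* Main.v *)
From mathcomp Require Import all_boot all_order all_algebra all_fingroup.
Require Import Defs.

(** Alternation forces the choice in every row of [M - P]. Colour an arc by
    whether the segment cut out by [C] that contains it ends at an
    over-passage (ascending) or at an under-passage (descending). A
    permutation [s] corresponding to [C] sends every turn, that is every
    under-passage of [C], to the over-strand at the same crossing; injectivity
    then propagates this choice along the segments: [s] runs along the
    descending segments as [next] does, and fixes the arcs of the ascending
    segments that do not end at [C] ([corresponds_eq]). This gives uniqueness.

    The contribution of [s] is its sign times a product over the rows. The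
    turns give the powers of [1 - u v] and [1 - (u v)^-1] ([prod_turn]). The
    fixed arcs lie on the ascending components, and their diagonal entries
    give the powers of [u] and [v] ([prod_fixed]). The rows in which [s]
    follows [next] have entry -1, and there are as many as descending arcs, say
    [d] ([prod_next]).

    For the sign, let [swap C] exchange the two incoming strands at each
    crossing of [C]. It has the parity of [m], and [swap C * s] is the
    smoothing on the descending arcs and the identity elsewhere. A permutation
    of [2n] arcs has the parity of [2n] minus its number of orbits; here there
    are [|L_d|] descending components and [2n - d] fixed arcs, so
    [s] has the parity of [m + |L_d| + d] ([odd_corresponds]). The [d] cancels
    against the product of the entries -1. *)

Import Order.TTheory GRing.Theory Num.Theory.
Local Open Scope ring_scope.

(** * Orbits of a permutation *)

Section Orbits.

Variable T : finType.
Implicit Types (p q : {perm T}) (A : {set T}) (x y : T).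

Lemma trivIset_porbits p : trivIset (porbits p).
Proof.
apply/trivIsetP=> _ _ /imsetP[x _ ->] /imsetP[y _ ->] neq_xy.
apply/pred0Pn=> -[z /= /andP[zx zy]]; case/negP: neq_xy.
rewrite -eq_porbit_mem in zx; rewrite -eq_porbit_mem in zy.
by rewrite -(eqP zx).
Qed.

Lemma porbit_fix p x : p x = x -> porbit p x = [set x].
Proof.
move=> px; apply/setP=> y; rewrite inE; apply/porbitP/eqP => [[k ->]|->].
  by elim: k => [|k IH]; rewrite ?expg0 ?perm1 // expgS permM px.
by exists 0%N; rewrite expg0 perm1.
Qed.

Lemma porbit_sub p A x :
  (forall y, (p y \in A) = (y \in A)) -> x \in A -> porbit p x \subset A.
Proof.
move=> stA xA; apply/subsetP=> _ /porbitP[k ->].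
by elim: k => [|k IH]; rewrite ?expg0 ?perm1 // expgSr permM stA.
Qed.

Lemma eq_porbit_in p q A x :
    (forall y, (p y \in A) = (y \in A)) -> {in A, p =1 q} -> x \in A ->
  porbit q x = porbit p x.
Proof.
move=> stA eqA xA.
have eqX k : ((q ^+ k) x = (p ^+ k) x)%g.
  elim: k => [|k IH]; rewrite ?expg0 // !expgSr !permM IH eqA //.
  by apply: (subsetP (porbit_sub p A x stA xA)); exact: mem_porbit.
by apply/setP=> y; apply/porbitP/porbitP => -[k ->]; exists k.
Qed.

(** Freezing the points outside an invariant set keeps the orbits inside the set
    and turns each point outside into an orbit of its own. This isolates the
    descending components when signs are computed from orbit counts. *)
Lemma card_porbits_restrict p q A :
    (forall y, (p y \in A) = (y \in A)) ->
    {in A, q =1 p} -> {in ~: A, q =1 id} ->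
  #|porbits q| = (#|[set K in porbits p | K \subset A]| + #|~: A|)%N.
Proof.
move=> stA qA qC.
have pqA : {in A, p =1 q} by move=> x xA; rewrite qA.
have -> : porbits q = [set K in porbits p | K \subset A] :|: set1 @: (~: A).
  apply/setP=> K; rewrite !inE; apply/imsetP/orP => [[x _ ->]|].
    have [xA|xA] := boolP (x \in A); [left | right].
      by rewrite (eq_porbit_in p q A) // imset_f ?porbit_sub.
    have xC : x \in ~: A by rewrite inE.
    by rewrite (porbit_fix _ _ (qC _ xC)) imset_f.
  case=> [/andP[/imsetP[x _ ->] sxA]|/imsetP[x xC ->]]; exists x => //.
    by rewrite (eq_porbit_in p q A) // (subsetP sxA) // porbit_id.
  by rewrite porbit_fix // qC.
rewrite cardsU (_ : _ :&: _ = set0) ?cards0 ?subn0 ?(card_imset _ set1_inj) //.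
apply/setP=> K; rewrite !inE; apply/negP => /andP[/andP[_ sKA] /imsetP[x]].
by rewrite inE => xA eK; move: sKA; rewrite eK sub1set (negPf xA).
Qed.

Lemma porbitT_ind p (Q : T -> Prop) x :
    (forall y z, z \in porbit p y) -> Q x -> (forall y, Q y -> Q (p y)) ->
  forall y, Q y.
Proof.
move=> cyc Qx Qp y; have /porbitP[k ->] := cyc x y.
by elim: k => [|k IH]; rewrite ?expg0 ?perm1 // expgSr permM; exact: Qp.
Qed.

End Orbits.

(** * Exchanging the two strands at the crossings of C *)

Section Swap.

Context {n : nat} (C : {set 'I_n}).
Implicit Types (i : 'I_n) (t : 'I_(n.*2)).

Lemma crossing_fst i : crossing (fst_arc i) = i.
Proof. by apply: val_inj; rewrite /= doubleK. Qed.

Lemma swap_subproof :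
  injective (fun t => if crossing t \in C then partner t else t).
Proof.
apply: inv_inj => t; case: (boolP (crossing t \in C)) => [Ct|/negPf->] //.
by rewrite crossing_partner Ct partnerK.
Qed.

(** The oriented smoothing factors as [swap] followed by [next], see
    [smoothingE]. *)
Definition swap : 'S_(n.*2) := perm swap_subproof.

Lemma swapE t : swap t = if crossing t \in C then partner t else t.
Proof. by rewrite permE. Qed.

Lemma swapK t : swap (swap t) = t.
Proof.
by rewrite !swapE; case: (boolP (crossing t \in C)) => [Ct|/negPf->] //;
  rewrite crossing_partner Ct partnerK.
Qed.

Lemma crossing_swap t : crossing (swap t) = crossing t.
Proof. by rewrite swapE; case: ifP => // _; rewrite crossing_partner. Qed.

Lemma prod_tpermE (r : seq 'I_n) t : uniq r ->
  (\prod_(i <- r) tperm (fst_arc i) (partner (fst_arc i)))%g t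
  = if crossing t \in r then partner t else t.
Proof.
elim: r t => [|i r IH] t /=; first by rewrite big_nil perm1.
case/andP=> ir ur; rewrite big_cons permM inE.
have [eti|nti] := eqVneq (crossing t) i.
  have -> : tperm (fst_arc i) (partner (fst_arc i)) t = partner t.
    have : crossing (fst_arc i) == crossing t by rewrite crossing_fst eti.
    rewrite same_crossing => /orP[/eqP->|/eqP->]; first by rewrite tpermL.
    by rewrite tpermR partnerK.
  by rewrite IH // crossing_partner eti (negPf ir).
rewrite tpermD ?IH //; apply: contraNneq nti => <-;
  by rewrite ?crossing_partner crossing_fst.
Qed.

Lemma odd_swap : odd_perm swap = odd #|C|.
Proof.
have -> : swap = (\prod_(i <- enum C)
                    tperm (fst_arc i) (partner (fst_arc i)))%g.
  by apply/permP=> t; rewrite prod_tpermE ?enum_uniq // mem_enum swapE.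
rewrite cardE.
elim: (enum C) => [|i r IH]; first by rewrite big_nil odd_perm1.
by rewrite big_cons odd_permM odd_tperm eq_sym partner_neq IH.
Qed.

End Swap.

(** * First passages through C *)

Lemma trajectS_pos (T : Type) (f : T -> T) x k :
  (0 < k)%N -> traject f x k = x :: traject f (f x) k.-1.
Proof. by case: k. Qed.

Lemma trajectSr_pos (T : Type) (f : T -> T) x k :
  (0 < k)%N -> traject f (f x) k = rcons (traject f (f x) k.-1) (iter k f x).
Proof. by case: k => // k _; rewrite trajectSr -iterSr. Qed.

Section FirstPassage.

Context {D : vknot} (C : {set 'I_(ncr D)}).
Implicit Types (t : arc D) (f : 'S_((ncr D).*2)).

Lemma narcs_gt0 : (0 < (ncr D).*2)%N.
Proof. by rewrite double_gt0 ncr_gt0. Qed.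

Lemma C_from_in (f : arc D -> arc D) t : crossing t \in C -> C_from C f t = t.
Proof. by rewrite /C_from (trajectS_pos _ _ _ _ narcs_gt0) /= => ->. Qed.

(** The two searches visit the arcs in the same order, except that the one from
    [t] meets [t] first and the one from [f t] meets [t] last. As [f] has a
    single cycle, both reach [c], so the default value of [C_from] is never
    used. *)
Lemma C_from_step f t c :
    (forall x y : arc D, y \in porbit f x) -> crossing c \in C ->
    crossing t \notin C ->
  C_from C f t = C_from C f (f t).
Proof.
move=> cyc Cc Ct.
have cardT x : #|porbit f x| = (ncr D).*2.
  by rewrite -[RHS]card_ord; apply: eq_card => y; rewrite cyc.
have fN : iter (ncr D).*2 f t = t by have := iter_porbit f t; rewrite cardT.
have : has (fun s : arc D => crossing s \in C) (traject f t (ncr D).*2).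
  apply/hasP; exists c => //.
  by have := porbit_traject f t c; rewrite cardT cyc.
rewrite /C_from (trajectSr_pos _ _ _ _ narcs_gt0) fN.
rewrite (trajectS_pos _ _ _ _ narcs_gt0) filter_rcons has_filter /= (negPf Ct).
by case: filter.
Qed.

End FirstPassage.

(** * Entries of the matrix *)

Lemma u_neq0 : u != 0.
Proof. by rewrite tofrac_eq0 polyC_eq0 polyX_eq0. Qed.

Lemma v_neq0 : v != 0.
Proof. by rewrite tofrac_eq0 polyX_eq0. Qed.

Lemma diag_entry (D : vknot) (t : arc D) :
  Mmx D t t = (if is_over t then v else u) ^ (- crossing_sign (crossing t)).
Proof.
rewrite mxE eqxx /is_over /crossing_sign.
by case: positive; case: odd => /=; rewrite ?opprK ?expr1z ?exprN1.
Qed.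

Lemma prod_exprz (F : fieldType) (I : finType) (P : pred I) (a : F)
    (k : I -> int) :
  a != 0 -> \prod_(i | P i) a ^ (- k i) = a ^ (- \sum_(i | P i) k i).
Proof.
move=> a0; rewrite -sumrN.
have aD x y : a ^ (x + y) = a ^ x * a ^ y by exact: expfzDr.
by rewrite (big_morph (fun j : int => a ^ j) aD (expr0z a)).
Qed.

Lemma is_over_partner (D : vknot) (t : arc D) :
  is_over (partner t) = ~~ is_over t.
Proof.
by rewrite /is_over crossing_partner odd_partner; case: odd positive => -[].
Qed.

Section TurnEntries.

Context {D : vknot} (C : {set 'I_(ncr D)}).

Definition turn_entry (i : 'I_(ncr D)) : Kuv :=
  if positive i then 1 - (u * v)^-1 else 1 - u * v.

Lemma prod_turn :
  \prod_(t | is_turn C t) turn_entry (crossing t)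
  = (1 - u * v) ^+ neg_count C * (1 - (u * v)^-1) ^+ pos_count C.
Proof.
pose under i : arc D := if positive i then fst_arc i else snd_arc i.
have crossing_under i : crossing (under i) = i.
  apply: val_inj; rewrite /under.
  by case: ifP; rewrite /= ?uphalf_double ?doubleK.
have under_under i : is_over (under i) = false.
  rewrite /is_over crossing_under /under.
  by case: (boolP (positive i)) => _; rewrite /= odd_double.
rewrite (reindex_onto under (@crossing _)) /=; last first.
  move=> t /andP[_ nt].
  have := eqxx (crossing t).
  rewrite -{1}(crossing_under (crossing t)) same_crossing.
  case/orP=> /eqP e; first by rewrite -e.
  by move: nt; rewrite e is_over_partner under_under.
under eq_bigl => i do rewrite /is_turn crossing_under under_under eqxx !andbT.
under eq_bigr => i _ do rewrite crossing_under.
rewrite (bigID (@positive D)) [RHS]mulrC /=; congr (_ * _).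
  rewrite (eq_bigr (fun=> 1 - (u * v)^-1)) => [|i /andP[_ pi]].
    by rewrite prodr_const /pos_count cardsE.
  by rewrite /turn_entry pi.
rewrite (eq_bigr (fun=> 1 - u * v)) => [|i /andP[_ ni]].
  by rewrite prodr_const /neg_count cardsE.
by rewrite /turn_entry (negPf ni).
Qed.

End TurnEntries.

(** * Segments of an alternating configuration *)

Section Alternating.

Context {D : vknot} (C : {set 'I_(ncr D)}).
Implicit Types t c : arc D.

(** For alternating [C] this says that the segment of [t] is ascending, see
    [ascendingE] and [descendingE]. *)
Definition ends_over t := is_over (seg_end C t).

Hypotheses (C_neq0 : C != set0) (alt : alternating C).

(** The arcs form a single cycle, so a property that passes from each arc to the
    next one holds everywhere as soon as it holds somewhere. Asking for it at
    all passages through [C] costs nothing in the applications, where it is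
    vacuous or immediate there. *)
Lemma arc_ind (Q : arc D -> Prop) :
    (forall c, crossing c \in C -> Q c) -> (forall t, Q t -> Q (next D t)) ->
  forall t, Q t.
Proof.
have /set0Pn[i iC] := C_neq0.
move=> QC Qn; apply: (porbitT_ind _ (next D) Q (fst_arc i)) => //.
  by move=> y z; exact: next_cycle.
by apply: QC; rewrite crossing_fst.
Qed.

Lemma arc_ind_rev (Q : arc D -> Prop) :
    (forall c, crossing c \in C -> Q c) -> (forall t, Q (next D t) -> Q t) ->
  forall t, Q t.
Proof.
have /set0Pn[i iC] := C_neq0.
move=> QC Qn; apply: (porbitT_ind _ (next D)^-1%g Q (fst_arc i)).
- by move=> y z; rewrite porbitV; exact: next_cycle.
- by apply: QC; rewrite crossing_fst.
by move=> t Qt; apply: Qn; rewrite permKV.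
Qed.

Lemma ends_over_in c : crossing c \in C -> ends_over c = is_over c.
Proof. by move=> Cc; rewrite /ends_over /seg_end C_from_in. Qed.

(** The only place where the alternation hypothesis enters directly: the segment
    leaving a passage through [C] ends at a passage of the other kind. *)
Lemma ends_over_next_in c :
  crossing c \in C -> ends_over (next D c) = ~~ is_over c.
Proof.
move=> Cc; have /forall_inP/(_ c Cc) := alt.
by rewrite /ends_over /seg_end; case: is_over; case: is_over.
Qed.

Lemma ends_over_next t :
  crossing t \notin C -> ends_over (next D t) = ends_over t.
Proof.
have /set0Pn[i iC] := C_neq0.
move=> Ct; rewrite /ends_over /seg_end.
rewrite [in RHS](C_from_step C _ t (fst_arc i)) //.
  by move=> x y; exact: next_cycle.
by rewrite crossing_fst.
Qed.

Lemma seg_start_next t :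
  seg_start C (next D t) = if crossing t \in C then t else seg_start C t.
Proof.
rewrite /seg_start permK; case: ifPn => Ct; first by rewrite C_from_in.
have /set0Pn[i iC] := C_neq0.
apply: (C_from_step C _ t (fst_arc i)) => //.
  by move=> x y; rewrite porbitV; exact: next_cycle.
by rewrite crossing_fst.
Qed.

(** Both sides are constant along a segment, and alternation gives the equality
    on the first arc of each segment. Hence every segment is either ascending
    or descending. *)
Lemma is_over_seg_start t : is_over (seg_start C t) = ~~ ends_over t.
Proof.
rewrite -[t](permKV (next D)); move: ((next D)^-1%g t) => {t}.
have step t : crossing t \in C ->
    is_over (seg_start C (next D t)) = ~~ ends_over (next D t).
  by move=> Ct; rewrite seg_start_next Ct ends_over_next_in // negbK.
apply: arc_ind => // t IH; have [|Ct] := boolP (crossing (next D t) \in C).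
  exact: step.
by rewrite seg_start_next (negPf Ct) ends_over_next.
Qed.

Lemma ascendingE t : ascending C t = ends_over t.
Proof. by rewrite /ascending is_over_seg_start negbK andbb. Qed.

Lemma descendingE t : descending C t = ~~ ends_over t.
Proof. by rewrite /descending is_over_seg_start andbb. Qed.

Lemma smoothingE t : smoothing C t = next D (swap C t).
Proof. by rewrite swapE permE. Qed.

(** Smoothing joins ascending segments to ascending ones: at a crossing of [C],
    passing to the other strand and then crossing into a new segment changes
    the kind of passage twice. *)
Lemma ends_over_smoothing t : ends_over (smoothing C t) = ends_over t.
Proof.
rewrite smoothingE swapE; case: ifPn => Ct; last exact: ends_over_next.
rewrite ends_over_next_in ?crossing_partner // is_over_partner negbK.
by rewrite ends_over_in.
Qed.

Lemma is_turnE t : is_turn C t = (crossing t \in C) && ~~ ends_over t.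
Proof. by rewrite /is_turn; case: (boolP (_ \in C)) => // /ends_over_in ->. Qed.

(** * The permutation corresponding to C and its contribution *)

(** A corresponding permutation is determined. The row of a turn [t] takes the
    column of the over-strand at the same crossing, so the over-strand itself
    cannot be fixed and must go to its successor. That successor then has its
    column used up, so it cannot be fixed either, and so on down the whole
    descending segment. Going backwards from an over-passage of [C], whose
    column is taken by a turn, the arcs of an ascending segment cannot go to
    their successor, so they are all fixed.

    The test on [swap C t] treats both kinds of non-turns at once: away from
    [C] it asks whether the segment of [t] is ascending, while for an
    over-passage [t] of [C] the arc [swap C t] is an under-passage, hence
    descending, and [t] goes to its successor. *)
Lemma corresponds_eq (s : 'S_((ncr D).*2)) :
    corresponds C s ->
  forall t, s t = if is_turn C t then partner t
                  else if ends_over (swap C t) then t else next D t.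
Proof.
move=> /forallP corr.
have turn t : is_turn C t -> s t = partner t.
  by move=> tt; have := corr t; rewrite tt => /eqP.
have stay_or_go t : ~~ is_turn C t -> s t = t \/ s t = next D t.
  by move=> /negPf nt; have := corr t; rewrite nt => /orP[]/eqP; [left | right].
have turn_partner t : crossing t \in C -> is_over t -> s (partner t) = t.
  move=> Ct ot; rewrite turn ?partnerK // /is_turn crossing_partner Ct.
  by rewrite is_over_partner ot.
have go_over t : crossing t \in C -> is_over t -> s t = next D t.
  move=> Ct ot; have [||//] := stay_or_go t; first by rewrite /is_turn Ct ot.
  rewrite -{2}(turn_partner t Ct ot) => /perm_inj/eqP.
  by rewrite eq_sym (negPf (partner_neq t)).
have go_desc :
    forall t, crossing t \notin C -> ~~ ends_over t -> s t = next D t.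
  apply: arc_ind => [c ->//|t IH nC].
  have [Ct|Ct] := boolP (crossing t \in C).
    rewrite ends_over_next_in // negbK => /(go_over t Ct) st.
    have [||//] := stay_or_go (next D t); first by rewrite /is_turn (negPf nC).
    by rewrite -{2}st => /perm_inj/eqP; rewrite (negPf (next_neq _)).
  rewrite ends_over_next // => /(IH Ct) st.
  have [||//] := stay_or_go (next D t); first by rewrite /is_turn (negPf nC).
  by rewrite -{2}st => /perm_inj/eqP; rewrite (negPf (next_neq _)).
have stay_asc : forall t, crossing t \notin C -> ends_over t -> s t = t.
  apply: arc_ind_rev => [c ->//|t IH nC et].
  have [|//|st] := stay_or_go t; first by rewrite /is_turn (negPf nC).
  have [Ct|Ct] := boolP (crossing (next D t) \in C).
    have ot : is_over (next D t) by rewrite -ends_over_in // ends_over_next.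
    have := turn_partner _ Ct ot; rewrite -{2}st => /perm_inj e.
    by rewrite -e crossing_partner Ct in nC.
  have := IH Ct; rewrite ends_over_next // => /(_ et); rewrite -{2}st.
  by move=> /perm_inj/eqP; rewrite (negPf (next_neq _)).
move=> t; rewrite swapE; case: (boolP (is_turn C t)) => [/turn //|nt].
have [Ct|Ct] := boolP (crossing t \in C); last first.
  by case: ifPn => et; [exact: stay_asc | exact: go_desc].
have ot : is_over t by move: nt; rewrite /is_turn Ct negbK.
by rewrite ends_over_in ?crossing_partner // is_over_partner ot go_over.
Qed.

Definition descending_arcs : {set arc D} := [set t | ~~ ends_over t].

(** The descending sublink in the form used by [card_porbits_restrict]. *)
Lemma L_dE : L_d C = [set K in components C | K \subset descending_arcs].
Proof.
apply/setP=> K; rewrite !inE; congr (_ && _).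
by apply/forall_inP/subsetP => H t /H; rewrite inE descendingE.
Qed.

Lemma cover_L_a : cover (L_a C) = [set t | ends_over t].
Proof.
apply/setP=> t; rewrite inE; apply/bigcupP/idP => [[K]|et].
  by rewrite inE => /andP[_ /forall_inP asc] /asc; rewrite ascendingE.
exists (porbit (smoothing C) t); last exact: porbit_id.
rewrite inE imset_f //=; apply/forall_inP=> x.
pose A := [set z | ends_over z].
have stA y : (smoothing C y \in A) = (y \in A).
  by rewrite !inE ends_over_smoothing.
have tA : t \in A by rewrite inE.
by move/(subsetP (porbit_sub _ _ _ _ stA tA)); rewrite inE ascendingE.
Qed.

(** The components are disjoint, so a sum over [L_a] runs once over each
    ascending arc. *)
Lemma sum_L_a (P : pred (arc D)) (F : arc D -> int) :
  \sum_(K in L_a C) \sum_(t in K | P t) F t = \sum_(t | ends_over t && P t) F t.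
Proof.
rewrite -big_trivIset_cond.
  by rewrite cover_L_a; apply: eq_bigl => t; rewrite inE.
apply: trivIsetS (trivIset_porbits _ (smoothing C)).
by apply/subsetP=> K /setIdP[].
Qed.

(** The permutation [swap C * s] is the smoothing on the descending arcs and the
    identity on the ascending ones. So its orbits are the descending
    components and the single ascending arcs, while [swap C] is a product of
    [#|C|] disjoint transpositions. *)
Lemma odd_corresponds (s : 'S_((ncr D).*2)) : corresponds C s ->
  odd_perm s = odd (#|C| + #|L_d C| + #|descending_arcs|).
Proof.
move=> cs; pose q := (swap C * s)%g.
have qE t : q t = if ends_over t then t else smoothing C t.
  rewrite permM (corresponds_eq _ cs) swapK smoothingE.
  rewrite /is_turn crossing_swap swapE.
  have [Ct|Ct] := boolP (crossing t \in C) => //=.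
  rewrite is_over_partner negbK partnerK ends_over_in //.
  by case: is_over.
have Cd : #|~: descending_arcs| = ((ncr D).*2 - #|descending_arcs|)%N.
  by rewrite cardsCs setCK card_ord.
have le_d : (#|descending_arcs| <= (ncr D).*2)%N.
  by rewrite -[leqRHS]card_ord max_card.
have oq : odd_perm q = odd (#|L_d C| + #|descending_arcs|).
  rewrite /odd_perm (card_porbits_restrict _ (smoothing C) _ descending_arcs).
  - by rewrite -L_dE Cd card_ord !oddD oddB // odd_double.
  - by move=> t; rewrite !inE ends_over_smoothing.
  - by move=> t; rewrite inE qE => /negPf->.
  - by move=> t; rewrite !inE negbK qE => ->.
have -> : s = (swap C * q)%g.
  by apply/permP=> t; rewrite !permM swapK.
by rewrite odd_permM odd_swap oq -oddD addnA.
Qed.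

(** Exactly one of the three tests succeeds, according to whether [t] is a turn,
    goes to its successor or is fixed. This splits the product over the rows
    into three products of simple factors. *)
Lemma contribution_entryE (s : 'S_((ncr D).*2)) t : corresponds C s ->
  contribution_entry C s t
  = (if is_turn C t then turn_entry (crossing t) else 1)
    * (if ~~ ends_over (swap C t) then -1 else 1)
    * (if ends_over t && (crossing t \notin C) then Mmx D t t else 1).
Proof.
move=> cs; rewrite /contribution_entry (corresponds_eq _ cs) is_turnE swapE.
case: (boolP (crossing t \in C)) => Ct /=.
  rewrite [ends_over (partner t)]ends_over_in ?crossing_partner //.
  rewrite is_over_partner andbF mulr1 ends_over_in //.
  by case: is_over; rewrite /= ?mulr1 // eqxx mul1r.
rewrite andbT mul1r; case: (ends_over t) => /=; last by rewrite eqxx mulr1.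
by rewrite eq_sym (negPf (next_neq t)) mul1r.
Qed.

(** The arcs going to their successor are the descending arcs, except that the
    turns are replaced by the over-passages of [C]. Both kinds occur once at
    each crossing of [C], and [swap C] exchanges them. *)
Lemma prod_next :
  \prod_(t : arc D) (if ~~ ends_over (swap C t) then -1 else 1)
  = (-1) ^+ #|descending_arcs| :> Kuv.
Proof.
rewrite (reindex_inj (@perm_inj _ (swap C))) /=.
under eq_bigr => t _ do rewrite swapK.
by rewrite -big_mkcond prodr_const /descending_arcs cardsE.
Qed.

(** The ascending arcs are the arcs of the components of [L_a], and the diagonal
    entry of an under- (over-) passage is [u] ([v]) to the power minus its
    sign. *)
Lemma prod_fixed :
  \prod_(t : arc D | ends_over t && (crossing t \notin C)) Mmx D t t
  = u ^ (- U_count C (L_a C)) * v ^ (- O_count C (L_a C)).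
Proof.
rewrite /U_count /O_count !sum_L_a (bigID (@is_over D)) [LHS]mulrC /=.
congr (_ * _).
  rewrite -(prod_exprz Kuv (arc D) _ u _ u_neq0).
  apply: eq_big => [t|t /andP[_ /negPf ot]]; first by rewrite andbA.
  by rewrite diag_entry ot.
rewrite -(prod_exprz Kuv (arc D) _ v _ v_neq0).
apply: eq_big => [t|t /andP[_ ot]]; first by rewrite andbA.
by rewrite diag_entry ot.
Qed.

Lemma contributionE (s : 'S_((ncr D).*2)) : corresponds C s ->
  contribution C s
  = (1 - u * v) ^+ neg_count C * (1 - (u * v)^-1) ^+ pos_count C
    * (-1) ^+ (#|C| + #|L_d C|)
    * u ^ (- U_count C (L_a C)) * v ^ (- O_count C (L_a C)).
Proof.
move=> cs; rewrite /contribution.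
under eq_bigr => t _ do rewrite contribution_entryE //.
rewrite !big_split /= prod_next -!big_mkcond prod_turn prod_fixed.
rewrite odd_corresponds //.
rewrite -[RHS]mulrA [LHS]mulrA; congr (_ * _).
rewrite [LHS]mulrCA; congr (_ * _).
rewrite signr_odd exprD -mulrA -exprD addnn -[X in _ * X]signr_odd odd_double.
by rewrite expr0 mulr1.
Qed.

End Alternating.

Theorem proposition4 (D : vknot) (C : {set 'I_(ncr D)}) (m : nat)
    (hm : (1 <= m)%N) (hC : #|C| = m) (halt : alternating C) :
  (forall s s' : 'S_((ncr D).*2),
     corresponds C s -> contribution C s != 0 ->
     corresponds C s' -> contribution C s' != 0 -> s = s')
  /\
  (forall s : 'S_((ncr D).*2),
     corresponds C s -> contribution C s != 0 ->
     contribution C s =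
       (1 - u * v) ^+ neg_count C * (1 - (u * v)^-1) ^+ pos_count C
       * (-1) ^+ (m + #|L_d C|)
       * u ^ (- U_count C (L_a C)) * v ^ (- O_count C (L_a C))).
Proof.
have C0 : C != set0 by rewrite -card_gt0 hC.
split=> [s s' cs _ cs' _|s cs _]; last by rewrite contributionE // hC.
apply/permP=> t; rewrite (corresponds_eq _ C0 halt s cs).
by rewrite (corresponds_eq _ C0 halt s' cs').
Qed.
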